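(* Let $a>b>0$, let $\mathcal{E}:\ \frac{\mathsf{x}^2}{a}+\frac{\mathsf{y}^2}{b}=1$, and let $\mathcal{C}_{\lambda_0}$, $\lambda_0\in(0,b)\cup(b,a)$, be a conic confocal with $\mathcal{E}$. Let $n\ge2$ be an integer. The billiard trajectories within $\mathcal{E}$ with caustic $\mathcal{C}_{\lambda_0}$ are $n$-elliptic periodic if and only if there exists a pair of real polynomials $\hat p_n$, $\hat q_{n-2}$ of degrees $n$ and $n-2$ respectively, such that the Pell equation $$\hat p_n^2(s)-s\left(s-\frac1a\right)\left(s-\frac1b\right)\left(s-\frac1{\lambda_0}\right)\hat q_{n-2}^2(s)=1$$ holds.
   Context: The confocal family is $\mathcal{C}_{\lambda}:\ \frac{\mathsf{x}^2}{a-\lambda}+\frac{\mathsf{y}^2}{b-\lambda}=1$; $\mathcal{C}_\lambda$ is an ellipse for $\lambda<b$, a hyperbola for $\lambda\in(b,a)$, with degenerate members the $\mathsf{x}$-axis ($\lambda=b$) and the $\mathsf{y}$-axis ($\lambda=a$). Billiard trajectories within $\mathcal{E}$ are polygonal lines with vertices on $\mathcal{E}$ obeying the reflection law at each vertex; a trajectory has caustic $\mathcal{C}_{\lambda_0}$ if all lines containing its segments are tangent to $\mathcal{C}_{\lambda_0}$. Every point other than the foci lies on exactly two conics $\mathcal{C}_{\lambda_1},\mathcal{C}_{\lambda_2}$, $\lambda_1<\lambda_2$; $(\lambda_1,\lambda_2)$ are its elliptic coordinates. A trajectory is $n$-elliptic periodic if it is $n$-periodic in elliptic coordinates, i.e.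 the elliptic coordinates of the moving point along the trajectory repeat periodically after $n$ reflections ($n$ not required to be minimal). *)

(* Defs.v *)
From mathcomp Require Import all_boot all_order all_algebra reals.

Set Implicit Arguments.
Unset Strict Implicit.
Unset Printing Implicit Defensive.

Import Order.TTheory GRing.Theory Num.Theory.
Local Open Scope ring_scope.

Section ConfocalBilliards.
Variable R : realType.
Variables a b : R.
Implicit Types (p q r u N m : 'rV[R]_2) (l : R).

Definition xcoord p : R := p 0 0.
Definition ycoord p : R := p 0 1.

Definition dot u v : R := \sum_i u 0 i * (v : 'rV[R]_2) 0 i.

(* The conic C_l of the confocal family; C_a and C_b are the coordinate axes. *)
Definition on_conic l p : Prop :=
  if l == a then xcoord p = 0
  else if l == b then ycoord p = 0
  else xcoord p ^+ 2 / (a - l) + ycoord p ^+ 2 / (b - l) = 1.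

(* Half the gradient at p of x^2/(a-l) + y^2/(b-l), a normal vector of C_l
   at p when l differs from a and b; the ellipse bounding the table is C_0. *)
Definition conic_normal l p : 'rV[R]_2 :=
  \row_i if i == 0 then xcoord p / (a - l) else ycoord p / (b - l).

Definition line_point p q (t : R) : 'rV[R]_2 := p + t *: (q - p).

(* Tangency of the line through p != q, for l different from a and b.  It is
   understood projectively: besides the tangents at points of C_l, the
   asymptotes of a hyperbola, which touch it at infinity, are included.  Since
   they pass through the center, billiard segments may lie on them. *)
Definition tangent_at_point l p q : Prop :=
  exists t, on_conic l (line_point p q t) /\
    dot (conic_normal l (line_point p q t)) (q - p) = 0.

Definition asymptote l p q : Prop :=
  (exists t, line_point p q t = 0) /\
  xcoord (q - p) ^+ 2 / (a - l) + ycoord (q - p) ^+ 2 / (b - l) = 0.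

Definition line_tangent l p q : Prop :=
  tangent_at_point l p q \/ asymptote l p q.

(* Mirror image of the direction u in the line orthogonal to N. *)
Definition mirror N u : 'rV[R]_2 := u - (2 * dot u N / dot N N) *: N.

(* The segment from q to r leaves in the direction obtained by mirroring the
   direction of the segment from p to q in the tangent to the table at q. *)
Definition reflection_law p q r : Prop :=
  exists c : R, 0 < c /\ r - q = c *: mirror (conic_normal 0 q) (q - p).

Definition billiard_trajectory (P : nat -> 'rV[R]_2) : Prop :=
  forall k, [/\ on_conic 0 (P k), P k != P k.+1
              & reflection_law (P k) (P k.+1) (P k.+2)].

Definition has_caustic l (P : nat -> 'rV[R]_2) : Prop :=
  forall k, line_tangent l (P k) (P k.+1).

Definition elliptic_coordinates p (l1 l2 : R) : Prop :=
  [/\ l1 < l2, on_conic l1 p & on_conic l2 p].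

Definition elliptic_periodic (n : nat) (P : nat -> 'rV[R]_2) : Prop :=
  forall k (t : R), 0 <= t <= 1 ->
  exists l1 l2 : R,
    elliptic_coordinates (line_point (P k) (P k.+1) t) l1 l2 /\
    elliptic_coordinates (line_point (P (k + n)%N) (P (k + n).+1) t) l1 l2.

End ConfocalBilliards.

(* Main.v *)
(* To a vertex p left in the direction d, attach the traceless 2x2 matrix
   L(s) = [[V, W], [U, -V]] of polynomials in s = 1/l, whose entries are the
   values of 1 - <p,p>_l, <p,d>_l and <d,d>_l for the confocal quadratic forms,
   with denominators cleared.  When the caustic is C_l0, -det L is a constant
   multiple of s (s - 1/a) (s - 1/b) (s - 1/l0).  Flying to the next vertex and
   bouncing there conjugates L by a matrix that has degree 1 in s and
   determinant 1.  The roots of U are the inverses of the elliptic coordinates,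
   and n-elliptic periodicity means that L returns to itself after n bounces.

   If it does, the product M of the n conjugating matrices commutes with L, so
   M = p + q L with p of degree n, and det M = 1 is the Pell equation.
   Conversely, a solution of the Pell equation gives M = p - q L, of determinant
   1 and commuting with L.  With the right sign of q its leading coefficient is
   such that multiplying M by each of the n conjugating matrices in turn lowers
   its degree by one.  The result is a constant matrix that intertwines the
   first and the last L, and this forces the two to be equal. *)

Require Import Defs.
From mathcomp Require Import all_boot all_order all_algebra reals.
From mathcomp Require Import ring lra zify.

Import Order.TTheory GRing.Theory Num.Theory.
Local Open Scope ring_scope.

(** The cofactor [k] serves as a certificate: once it is given, only a polynomial identity is left
    for [ring]. *)
Lemma lincomb {A : pzRingType} {k x y e1 e2 : A} :
  e1 = e2 -> x - y = k * (e1 - e2) -> x = y.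
Proof. by move=> -> /eqP; rewrite subrr mulr0 subr_eq0 => /eqP. Qed.

Lemma lincomb2 {A : pzRingType} {k l x y e1 e2 f1 f2 : A} :
  e1 = e2 -> f1 = f2 -> x - y = k * (e1 - e2) + l * (f1 - f2) -> x = y.
Proof.
by move=> -> -> /eqP; rewrite !subrr !mulr0 addr0 subr_eq0 => /eqP.
Qed.

(** * Two-by-two matrices; flight and bounce as conjugations *)

Section LaxMatrices.
Set Implicit Arguments.
Unset Strict Implicit.
Variable A : comPzRingType.
Implicit Types (m U V W t c X : A) (M : 'M[A]_2).

Definition mx2 m11 m12 m21 m22 : 'M[A]_2 :=
  \matrix_(i, j) if i == 0 then if j == 0 then m11 else m12
                 else if j == 0 then m21 else m22.

Lemma mx2_inj m11 m12 m21 m22 m11' m12' m21' m22' :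
  mx2 m11 m12 m21 m22 = mx2 m11' m12' m21' m22' ->
  [/\ m11 = m11', m12 = m12', m21 = m21' & m22 = m22'].
Proof.
move/matrixP=> E.
by split; [have := E 0 0 | have := E 0 1 | have := E 1 0 | have := E 1 1];
  rewrite !mxE.
Qed.

Lemma mx2E M : M = mx2 (M 0 0) (M 0 1) (M 1 0) (M 1 1).
Proof.
apply/matrixP=> i j; rewrite mxE.
by case: i j => [[|[|//]] hi] [[|[|//]] hj] /=; congr (M _ _); apply: val_inj.
Qed.

Lemma mulmx2 m11 m12 m21 m22 m11' m12' m21' m22' :
  mx2 m11 m12 m21 m22 *m mx2 m11' m12' m21' m22' =
  mx2 (m11 * m11' + m12 * m21') (m11 * m12' + m12 * m22')
      (m21 * m11' + m22 * m21') (m21 * m12' + m22 * m22').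
Proof.
apply/matrixP=> i j; rewrite !mxE big_ord_recl big_ord1 !mxE /=.
by case: (i == 0); case: (j == 0).
Qed.

Lemma det_mx2 m11 m12 m21 m22 :
  \det (mx2 m11 m12 m21 m22) = m11 * m22 - m12 * m21.
Proof.
rewrite (expand_det_row _ 0) big_ord_recl big_ord1 /cofactor !det_mx11 !mxE /=.
by rewrite expr0 expr1 mul1r mulN1r mulrN.
Qed.

Definition lax U V W := mx2 V W U (- V).

(* The flight of length t turns V into V + t W; the bounce then adds c X U. *)
Definition billiard_step t c X := mx2 (1 - t * c * X) (c * X) (- t) 1.

Lemma lax_flow U V W t :
  lax (U - 2 * t * V - t ^+ 2 * W) (V + t * W) W *m mx2 1 0 (- t) 1 =
  mx2 1 0 (- t) 1 *m lax U V W.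
Proof. by rewrite !mulmx2; congr mx2; ring. Qed.

Lemma lax_bounce U V W c X :
  lax U (V + c * X * U) (W - 2 * c * X * V - c ^+ 2 * X ^+ 2 * U)
    *m mx2 1 (c * X) 0 1 = mx2 1 (c * X) 0 1 *m lax U V W.
Proof. by rewrite !mulmx2; congr mx2; ring. Qed.

Lemma intertwine_trans (L L1 L0 B M : 'M[A]_2) :
  L1 *m B = B *m L -> L *m M = M *m L0 -> L1 *m (B *m M) = B *m M *m L0.
Proof. by move=> h1 h2; rewrite mulmxA h1 -mulmxA h2 mulmxA. Qed.

End LaxMatrices.

(** * Degree bounds and top coefficients *)

Section TopCoefficients.
Set Implicit Arguments.
Unset Strict Implicit.
Variable R : nzRingType.
Implicit Types p q : {poly R}.

Lemma coefM_top p q i j k :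
  (size p <= i.+1)%N -> (size q <= j.+1)%N -> k = (i + j)%N ->
  (p * q)`_k = p`_i * q`_j.
Proof.
move=> hp hq ->; have hi : (i < (i + j).+1)%N by lia.
rewrite coefM (bigD1 (Ordinal hi)) //= addKn big1 ?addr0 // => l /eqP li.
have [il|li'] := ltnP i l.
  by rewrite (nth_default _ (leq_trans hp il)) mul0r.
have {li li'}: (l < i)%N.
  by rewrite ltn_neqAle li' andbT; apply/eqP => e; apply/li/val_inj.
move=> li; rewrite [q`__]nth_default ?mulr0 //.
by apply: leq_trans hq _; lia.
Qed.

Lemma coefM_gt p q i j k :
  (size p <= i.+1)%N -> (size q <= j)%N -> k = (i + j)%N ->
  (p * q)`_k = 0.
Proof.
move=> hp hq ->; rewrite (coefM_top hp (leqW hq)) //.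
by rewrite [q`_j]nth_default ?mulr0.
Qed.

Lemma size_le_coef p d : (size p <= d.+1)%N -> p`_d = 0 -> (size p <= d)%N.
Proof.
move=> hp h0; apply/leq_sizeP => j; rewrite leq_eqVlt => /predU1P[<- //|dj].
exact/nth_default/(leq_trans hp).
Qed.

Lemma size_eq_coef p d : (size p <= d.+1)%N -> p`_d != 0 -> size p = d.+1.
Proof.
move=> hp h0; apply/eqP; rewrite eqn_leq hp ltnNge.
by apply: contra h0 => h; rewrite nth_default.
Qed.

Lemma coef_size p d : size p = d.+1 -> p`_d != 0.
Proof.
move=> hp; have -> : p`_d = lead_coef p by rewrite lead_coefE hp.
by rewrite lead_coef_eq0 -size_poly_gt0 hp.
Qed.

Lemma size_polyDleq p q d :
  (size p <= d)%N -> (size q <= d)%N -> (size (p + q)%R <= d)%N.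
Proof. by move=> hp hq; rewrite (leq_trans (size_polyD _ _)) // geq_max hp. Qed.

Lemma size_polyBleq p q d :
  (size p <= d)%N -> (size q <= d)%N -> (size (p - q)%R <= d)%N.
Proof. by move=> hp hq; apply: size_polyDleq; rewrite ?size_polyN. Qed.

Lemma size_polyMtop p q i j k : (size p <= i.+1)%N -> (size q <= j.+1)%N ->
  k = (i + j)%N -> (size (p * q)%R <= k.+1)%N.
Proof.
move=> hp hq ->; apply: leq_trans (size_polyMleq _ _) _.
by have := leq_add hp hq; set m := (size p + size q)%N => h; lia.
Qed.

Lemma size_mulCleq a p d : (size p <= d)%N -> (size (a%:P * p)%R <= d)%N.
Proof. by move=> hp; rewrite mul_polyC (leq_trans (size_scale_leq _ _)). Qed.

Lemma size_mulXleq p d : (size p <= d)%N -> (size ('X * p)%R <= d.+1)%N.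
Proof.
move=> hp; rewrite -commr_polyX (leq_trans (size_polyMleq _ _)) // size_polyX.
by lia.
Qed.

End TopCoefficients.

(** * Coordinates in the plane *)

Section Coordinates.
Set Implicit Arguments.
Unset Strict Implicit.
Variable R : realType.
Implicit Types (p q : 'rV[R]_2) (x y t : R).

Definition point x y : 'rV[R]_2 := \row_i if i == 0 then x else y.

Lemma pointE p : p = point (xcoord p) (ycoord p).
Proof.
apply/rowP=> i; rewrite mxE /xcoord /ycoord.
by case: i => [[|[|//]] hi] /=; congr (p _ _); apply: val_inj.
Qed.

Lemma xcoord_point x y : xcoord (point x y) = x. Proof. by rewrite /xcoord mxE. Qed.

Lemma ycoord_point x y : ycoord (point x y) = y. Proof. by rewrite /ycoord mxE. Qed.

Lemma xcoordB p q : xcoord (p - q) = xcoord p - xcoord q.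
Proof. by rewrite /xcoord !mxE. Qed.

Lemma ycoordB p q : ycoord (p - q) = ycoord p - ycoord q.
Proof. by rewrite /ycoord !mxE. Qed.

Lemma xcoordZ k p : xcoord (k *: p) = k * xcoord p.
Proof. by rewrite /xcoord mxE. Qed.

Lemma ycoordZ k p : ycoord (k *: p) = k * ycoord p.
Proof. by rewrite /ycoord mxE. Qed.

Lemma xcoord_line p q t :
  xcoord (line_point p q t) = xcoord p + t * (xcoord q - xcoord p).
Proof. by rewrite /xcoord /line_point !mxE. Qed.

Lemma ycoord_line p q t :
  ycoord (line_point p q t) = ycoord p + t * (ycoord q - ycoord p).
Proof. by rewrite /ycoord /line_point !mxE. Qed.

Lemma dotE p q : dot p q = xcoord p * xcoord q + ycoord p * ycoord q.
Proof.
rewrite /dot big_ord_recl big_ord1 /xcoord /ycoord.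
by congr (_ + p _ _ * q _ _); apply: val_inj.
Qed.

Lemma coord_eq p q : xcoord p = xcoord q -> ycoord p = ycoord q -> p = q.
Proof. by move=> ex ey; rewrite (pointE p) (pointE q) ex ey. Qed.

Lemma coord_neq0 p : p != 0 -> xcoord p != 0 \/ ycoord p != 0.
Proof.
move=> p0; have [x0|?] := eqVneq (xcoord p) 0; last by left.
right; apply: contra p0 => /eqP y0; apply/eqP/coord_eq.
  by rewrite x0 /xcoord mxE.
by rewrite y0 /ycoord mxE.
Qed.

Lemma mirrorZ N t p : mirror N (t *: p) = t *: mirror N p.
Proof.
rewrite /mirror !dotE xcoordZ ycoordZ scalerBr scalerA; congr (_ - _ *: _).
by rewrite -!mulrA -mulrDr !mulrA [2 * t]mulrC.
Qed.

Lemma conic_normalE (a b l : R) p :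
  conic_normal a b l p = point (xcoord p / (a - l)) (ycoord p / (b - l)).
Proof. by []. Qed.

End Coordinates.

(** * Confocal conics and elliptic coordinates *)

Section ConfocalFamily.
Set Implicit Arguments.
Unset Strict Implicit.
Variables (R : realType) (a b : R).
Hypothesis b_lt_a : b < a.
Implicit Types (p q : 'rV[R]_2) (l t : R).

(** Clearing denominators absorbs the degenerate members: at [l = a] the equation reads
    [x^2 (b - a) = 0], at [l = b] it reads [y^2 (a - b) = 0]. *)
Lemma on_conicP l p : on_conic a b l p <->
  (a - l) * (b - l) = xcoord p ^+ 2 * (b - l) + ycoord p ^+ 2 * (a - l).
Proof.
have b_neq_a : b - a != 0 by rewrite subr_eq0 lt_eqF.
rewrite /on_conic; have [->|la] := eqVneq l a.
  rewrite subrr mul0r mulr0 addr0; split=> [->|/esym/eqP].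
    by rewrite expr0n mul0r.
  by rewrite mulf_eq0 (negPf b_neq_a) orbF sqrf_eq0 => /eqP.
have [->|lb] := eqVneq l b.
  rewrite subrr !mulr0 add0r; split=> [->|/esym/eqP].
    by rewrite expr0n mul0r.
  by rewrite mulf_eq0 -opprB oppr_eq0 (negPf b_neq_a) orbF sqrf_eq0 => /eqP.
have la' : a - l != 0 by rewrite subr_eq0 eq_sym.
have lb' : b - l != 0 by rewrite subr_eq0 eq_sym.
have lab := mulf_neq0 la' lb'.
have e : xcoord p ^+ 2 * (b - l) + ycoord p ^+ 2 * (a - l) =
    (a - l) * (b - l) * (xcoord p ^+ 2 / (a - l) + ycoord p ^+ 2 / (b - l)).
  by field; rewrite la' lb'.
rewrite e; split=> [->|/esym]; first by rewrite mulr1.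
by rewrite -[RHS]mulr1 => /(mulfI lab).
Qed.

Lemma on_ellipseP p :
  on_conic a b 0 p <-> b * xcoord p ^+ 2 + a * ycoord p ^+ 2 = a * b.
Proof.
rewrite on_conicP !subr0 ![_ ^+ 2 * _]mulrC.
by split=> ->.
Qed.

(** The two conic equations are linear in [x^2] and [y^2]. Their difference is divisible by
    [l1 - l2] and yields [x^2 + y^2]; then [a - b != 0] separates the squares. *)
Lemma elliptic_coordinates_sqr p q l1 l2 :
  elliptic_coordinates a b p l1 l2 -> elliptic_coordinates a b q l1 l2 ->
  xcoord p ^+ 2 = xcoord q ^+ 2 /\ ycoord p ^+ 2 = ycoord q ^+ 2.
Proof.
case=> [l12 /on_conicP e1 /on_conicP e2] [_ /on_conicP f1 /on_conicP f2].
have {e1}f1 := etrans (esym e1) f1; have {e2}f2 := etrans (esym e2) f2.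
move: f1 f2; move: (xcoord p ^+ 2) (ycoord p ^+ 2) => X Y.
move: (xcoord q ^+ 2) (ycoord q ^+ 2) => X' Y' f1 f2.
have s : X + Y = X' + Y'.
  have /mulfI : l1 - l2 != 0 by rewrite subr_eq0 lt_eqF.
  by apply; apply: (lincomb2 (k := -1) (l := 1) f1 f2); ring.
have /mulfI ab : a - b != 0 by rewrite subr_eq0 gt_eqF.
have eY : Y = Y' by apply/ab/(lincomb2 (k := - (b - l1)) (l := 1) s f1); ring.
by split=> //; move: s; rewrite eY => /addIr.
Qed.

Lemma elliptic_coordinates_eq_sqr p q l1 l2 :
  xcoord p ^+ 2 = xcoord q ^+ 2 -> ycoord p ^+ 2 = ycoord q ^+ 2 ->
  elliptic_coordinates a b p l1 l2 -> elliptic_coordinates a b q l1 l2.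
Proof.
move=> ex ey [l12 /on_conicP + /on_conicP]; rewrite ex ey => e1 e2.
by split=> //; apply/on_conicP.
Qed.

(** For a fixed point the cleared conic equation is a monic quadratic in [l], with sum of roots [S]
    and discriminant [D]. Written as a sum of two squares, [D] is seen to vanish only at the
    foci. *)
Lemma elliptic_coordinates_exist p : ycoord p != 0 \/ xcoord p ^+ 2 != a - b ->
  exists l1 l2, elliptic_coordinates a b p l1 l2.
Proof.
move=> H; pose S := a + b - xcoord p ^+ 2 - ycoord p ^+ 2.
pose D := (a - b - xcoord p ^+ 2 + ycoord p ^+ 2) ^+ 2 +
          (2 * xcoord p * ycoord p) ^+ 2.
have D_gt0 : 0 < D.
  rewrite lt_def addr_ge0 ?sqr_ge0 // andbT paddr_eq0 ?sqr_ge0 // !sqrf_eq0.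
  rewrite !mulf_eq0 pnatr_eq0 /=; apply/negP => /andP[/eqP e /orP[]/eqP e0].
    have h : 0 < a - b + ycoord p ^+ 2 by rewrite ltr_wpDr ?sqr_ge0 // subr_gt0.
    by move: h e; rewrite e0 expr0n subr0 => + h; rewrite h ltxx.
  case: H; rewrite ?e0 ?eqxx // => /eqP; apply.
  by apply: (lincomb (k := -1) e); rewrite e0; ring.
have sD : Num.sqrt D ^+ 2 = D by rewrite sqr_sqrtr // ltW.
have two : 2 != 0 :> R by rewrite pnatr_eq0.
exists ((S - Num.sqrt D) / 2), ((S + Num.sqrt D) / 2); split.
- have : 0 < Num.sqrt D by rewrite sqrtr_gt0.
  by move: (Num.sqrt D) => d d_gt0; lra.
- apply/on_conicP; apply: (lincomb (k := 4^-1) sD).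
  by rewrite /D /S; field.
apply/on_conicP; apply: (lincomb (k := 4^-1) sD).
by rewrite /D /S; field.
Qed.

End ConfocalFamily.

(** * Rays, bounces and their Lax matrices *)

Section Rays.
Set Implicit Arguments.
Unset Strict Implicit.
Variables (R : realType) (a b l0 : R).
Hypotheses (b_gt0 : 0 < b) (b_lt_a : b < a).
Hypothesis l0_caustic : (0 < l0 /\ l0 < b) \/ (b < l0 /\ l0 < a).

(* A vertex of a trajectory with the direction in which it is left; the
   direction is the mirror image of the previous one, so its length is
   constant along a trajectory. *)
Record ray := Ray { rx : R; ry : R; ru : R; rv : R }.
Implicit Types (z : ray) (t c : R) (p q : {poly R}).

Definition on_table z := b * rx z ^+ 2 + a * ry z ^+ 2 = a * b.
Definition energy z := ru z ^+ 2 + rv z ^+ 2.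
Definition scaled_energy z := b * ru z ^+ 2 + a * rv z ^+ 2.
Definition heading z := b * rx z * ru z + a * ry z * rv z.
Definition cross z := rx z * rv z - ry z * ru z.

(* Tangency to C_l0: the discriminant <p,d>^2 + <d,d> (1 - <p,p>) of the line
   vanishes for the form of parameter l0. *)
Definition tangent_ray z := scaled_energy z - cross z ^+ 2 = l0 * energy z.

Definition launched z := [/\ on_table z, heading z < 0 & tangent_ray z].

(* With s = 1/l and <.,.>_l the form x x'/(a-l) + y y'/(b-l), these are the
   multiples by s^2 (a-l)(b-l) of 1 - <p,p>_l, <p,d>_l and <d,d>_l, where p is
   the position and d the direction. *)
Definition laxU z : {poly R} :=
  1 + (rx z ^+ 2 + ry z ^+ 2 - a - b)%:P * 'X
    + (a * b - b * rx z ^+ 2 - a * ry z ^+ 2)%:P * 'X^2.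
Definition laxV z : {poly R} :=
  - (rx z * ru z + ry z * rv z)%:P * 'X + (heading z)%:P * 'X^2.
Definition laxW z : {poly R} :=
  - (energy z)%:P * 'X + (scaled_energy z)%:P * 'X^2.
Definition lax_ray z := lax (laxU z) (laxV z) (laxW z).

(** With the normal [N = (x'/a, y'/b)], the last equation says [c = 2 <d,N> / <N,N>], multiplied out
    to avoid the division. *)
Definition bounce t c z z' :=
  [/\ 0 < t, rx z' = rx z + t * ru z, ry z' = ry z + t * rv z,
      ru z' = ru z - c * (rx z' / a) /\ rv z' = rv z - c * (ry z' / b)
    & c * ((rx z' / a) ^+ 2 + (ry z' / b) ^+ 2) =
      2 * (ru z * (rx z' / a) + rv z * (ry z' / b))].

Let a_gt0 : 0 < a. Proof. exact: lt_trans b_lt_a. Qed.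
Let a_neq0 : a != 0. Proof. exact: lt0r_neq0. Qed.
Let b_neq0 : b != 0. Proof. exact: lt0r_neq0. Qed.
Let l0_gt0 : 0 < l0.
Proof. by case: l0_caustic => -[// h _]; apply: lt_trans h. Qed.

Lemma normal_neq0 z : on_table z -> (rx z / a) ^+ 2 + (ry z / b) ^+ 2 != 0.
Proof.
rewrite /on_table paddr_eq0 ?sqr_ge0 // !sqrf_eq0 !mulf_eq0 !invr_eq0.
rewrite (negPf a_neq0) (negPf b_neq0) !orbF => E.
apply/negP => /andP[/eqP x0 /eqP y0]; move: E.
rewrite x0 y0 expr0n /= !mulr0 addr0 => /esym/eqP.
by rewrite mulf_eq0 (negPf a_neq0) (negPf b_neq0).
Qed.

(** On the table [U1 = - a b <N,N>] and [V1 = a b <d,N>], so the mirror law becomes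
    [2 * V1 + c * U1 = 0]. All five identities are combinations of this law and the table
    equation. *)
Lemma bounce_scalars z z' t c : on_table z' -> bounce t c z z' ->
  let V1 := b * rx z' * ru z + a * ry z' * rv z in
  let U1 := rx z' ^+ 2 + ry z' ^+ 2 - a - b in
  [/\ energy z' = energy z,
      rx z' * ru z' + ry z' * rv z' = rx z' * ru z + ry z' * rv z - c,
      heading z' = V1 + c * U1, 2 * V1 + c * U1 = 0
    & scaled_energy z' =
      scaled_energy z + 2 * c * (rx z' * ru z + ry z' * rv z) - c ^+ 2].
Proof.
case: z z' => x y u v [x' y' u' v'] E [/= _ _ _ [-> ->]].
rewrite /on_table /energy /heading /scaled_energy /= in E *.
have ->: x' = a * (x' / a) by field.
have ->: y' = b * (y' / b) by field.
have {E}: a * (x' / a) ^+ 2 + b * (y' / b) ^+ 2 = 1.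
  apply: (lincomb (k := (a * b)^-1) E).
  by field; rewrite a_neq0 b_neq0.
move: (x' / a) (y' / b) => p q E.
have -> : a * p / a = p by field.
have -> : b * q / b = q by field.
move=> C; split.
- by apply: (lincomb (k := c) C); ring.
- by apply: (lincomb (k := - c) E); ring.
- by apply: (lincomb (k := - (c * (a + b))) E); ring.
- by apply: (lincomb2 (k := c * (a + b)) (l := - (a * b)) E C); ring.
by apply: (lincomb2 (k := - c ^+ 2) (l := c * (a + b)) E C); ring.
Qed.

Lemma laxU_on_table z : on_table z ->
  laxU z = 1 + (rx z ^+ 2 + ry z ^+ 2 - a - b)%:P * 'X.
Proof.
move=> E; rewrite /laxU.
have -> : a * b - b * rx z ^+ 2 - a * ry z ^+ 2 = 0 by rewrite -E; ring.
by rewrite mul0r addr0.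
Qed.

Lemma laxU_bounce z z' t c : bounce t c z z' ->
  laxU z' = laxU z - 2 * t%:P * laxV z - t%:P ^+ 2 * laxW z.
Proof.
case=> _ ex ey _ _.
by rewrite /laxU /laxV /laxW /energy /scaled_energy /heading ex ey; ring.
Qed.

(** By partial fractions [1/(a (a-l)) = s (1/(a-l) - 1/a)], hence [<p',N>_l = s (<p',p'>_l - 1)] on
    the table. Subtracting [c N] from the direction thus adds [c s] times the entry U. *)
Lemma laxV_bounce z z' t c : on_table z' -> bounce t c z z' ->
  laxV z' = (laxV z + t%:P * laxW z) + c%:P * 'X * laxU z'.
Proof.
move=> E B; have [_ e1 e2 _ _] := bounce_scalars E B.
case: B => _ ex ey _ _.
rewrite (laxU_on_table E) /laxV /laxW e1 e2 /energy /scaled_energy /heading ex ey.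
by ring.
Qed.

Lemma laxW_bounce z z' t c : on_table z' -> bounce t c z z' ->
  laxW z' = laxW z - 2 * c%:P * 'X * (laxV z + t%:P * laxW z)
            - c%:P ^+ 2 * 'X^2 * laxU z'.
Proof.
move=> E B; have [e0 _ _ e3 e4] := bounce_scalars E B.
case: B => _ ex ey _ _.
rewrite (laxU_on_table E) /laxV /laxW e0 e4.
(* The two sides differ only in degree 3, by [c] times [2 V1 + c U1], which the mirror law
   annihilates. *)
apply: (lincomb (k := c%:P * 'X^3) (congr1 polyC e3)).
by rewrite /energy /scaled_energy /heading ex ey; ring.
Qed.

Lemma lax_ray_bounce z z' t c : on_table z' -> bounce t c z z' ->
  let B := billiard_step t%:P c%:P 'X in
  lax_ray z' *m B = B *m lax_ray z.
Proof.
move=> E B /=.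
have -> : billiard_step t%:P c%:P 'X =
    mx2 1 (c%:P * 'X) 0 1 *m mx2 1 0 (- t%:P) 1 :> 'M[{poly R}]_2.
  by rewrite mulmx2; congr mx2; ring.
apply: intertwine_trans (lax_flow _ _ _ _).
rewrite -(laxU_bounce B) /lax_ray (laxV_bounce E B) (laxW_bounce E B).
exact: lax_bounce.
Qed.

(** Up to denominators, the discriminant of the line for the form of parameter [l] is [scaled_energy
    z - cross z ^+ 2 - l * energy z]. It is affine in [l], and tangency places its root at [l0]; the
    factors at [1/a] and [1/b] come from the denominators. *)
Lemma det_lax_ray z : tangent_ray z ->
  laxV z ^+ 2 + laxU z * laxW z =
  (energy z)%:P * 'X * (a%:P * 'X - 1) * (b%:P * 'X - 1) * (l0%:P * 'X - 1).
Proof.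
move=> T; apply: (lincomb (k := 'X^2 * (a%:P * 'X - 1) * (b%:P * 'X - 1))
  (congr1 polyC T)).
by rewrite /laxV /laxU /laxW /cross /energy /scaled_energy /heading; ring.
Qed.

(** Joachimsthal's integral. Both ends of the chord are on the ellipse, which fixes [t] and makes
    the heading on arrival the negative of the heading at departure; the mirror reverses the sign
    again. *)
Lemma heading_bounce z z' t c : on_table z -> on_table z' -> bounce t c z z' ->
  2 * heading z + t * scaled_energy z = 0 /\ heading z' = heading z.
Proof.
move=> E E' B; have [_ _ e2 e3 _] := bounce_scalars E' B.
case: B => t_gt0 ex ey _ _.
have e : 2 * heading z + t * scaled_energy z = 0.
  apply: (mulfI (lt0r_neq0 t_gt0)); rewrite mulr0.
  rewrite /on_table ex ey -E in E'.
  by apply: (lincomb (k := 1) E'); rewrite /heading /scaled_energy; ring.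
split=> //; rewrite e2; apply: (lincomb2 (k := 1) (l := -1) e3 e).
by rewrite ex ey /heading /scaled_energy; ring.
Qed.

Lemma heading_sqr z : on_table z -> tangent_ray z ->
  heading z ^+ 2 = a * b * l0 * energy z.
Proof.
move=> E T; apply: (lincomb2 (k := scaled_energy z) (l := a * b) E T).
by rewrite /cross /heading /scaled_energy; ring.
Qed.

Lemma launched_energy z : launched z -> 0 < energy z.
Proof.
case=> E h T; have := heading_sqr E T.
have : 0 < heading z ^+ 2 by rewrite exprn_even_gt0 //= lt_eqF.
move=> + e; rewrite e pmulr_rgt0 // !mulr_gt0 //.
Qed.

(** On the table, tangency to the caustic amounts to [heading z ^+ 2 = a * b * l0 * energy z], and a
    bounce preserves heading and energy. *)
Lemma launched_bounce z z' t c : launched z -> on_table z' -> bounce t c z z' ->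
  launched z'.
Proof.
case=> E h T E' B; have [_ eh] := heading_bounce E E' B.
split=> //; first by rewrite eh.
have [ee _ _ _ _] := bounce_scalars E' B.
apply: (mulfI (mulf_neq0 a_neq0 b_neq0)).
apply: (lincomb2 (k := - scaled_energy z') (l := 1) E' (heading_sqr E T)).
by rewrite -eh -ee /cross /heading /scaled_energy; ring.
Qed.

(** * Degree descent under a bounce *)

Lemma size_laxV z : (size (laxV z) <= 3)%N.
Proof.
rewrite /laxV -polyCN !mul_polyC; apply: size_polyDleq.
  by rewrite (leq_trans (size_scale_leq _ _)) // size_polyX.
by rewrite (leq_trans (size_scale_leq _ _)) // size_polyXn.
Qed.

Lemma size_laxW z : (size (laxW z) <= 3)%N.
Proof.
rewrite /laxW -polyCN !mul_polyC; apply: size_polyDleq.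
  by rewrite (leq_trans (size_scale_leq _ _)) // size_polyX.
by rewrite (leq_trans (size_scale_leq _ _)) // size_polyXn.
Qed.

Lemma size_laxU z : on_table z -> (size (laxU z) <= 2)%N.
Proof.
move=> E; rewrite laxU_on_table // mul_polyC; apply: size_polyDleq.
  by rewrite size_poly1.
by rewrite (leq_trans (size_scale_leq _ _)) // size_polyX.
Qed.

Lemma laxV_coef2 z : (laxV z)`_2 = heading z.
Proof. by rewrite /laxV -polyCN !mul_polyC coefD !coefZ coefX coefXn /=; ring. Qed.

Lemma laxU_coef0 z : (laxU z)`_0 = 1.
Proof. by rewrite /laxU !mul_polyC !coefD !coefZ coef1 coefX coefXn /=; ring. Qed.

Lemma laxV_coef0 z : (laxV z)`_0 = 0.
Proof. by rewrite /laxV -polyCN !mul_polyC coefD !coefZ coefX coefXn /=; ring. Qed.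

(** The terms of degree [d > 0] are confined to the second column. The [maxn] admits a constant
    upper left entry when [d = 0]. *)
Definition reduced d (M : 'M[{poly R}]_2) :=
  [/\ size (M 1 1) = d.+1, (size (M 0%R 1%R) <= d.+1)%N,
      (size (M 1%R 0%R) <= d)%N & (size (M 0%R 0%R) <= maxn d 1)%N].

Lemma reduced_mx2 d m11 m12 m21 m22 :
  reduced d (mx2 m11 m12 m21 m22) <->
  [/\ size m22 = d.+1, (size m12 <= d.+1)%N, (size m21 <= d)%N
    & (size m11 <= maxn d 1)%N].
Proof. by rewrite /reduced !mxE. Qed.

(* Before the bounce the two eigenvalues of the leading coefficient of the Lax
   matrix are exchanged with respect to z0, which forces each of the two
   factors of a step to lower the degree of a column of M. *)
Lemma reduced_step d z0 z z' t c M :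
    launched z0 -> launched z -> heading z = heading z0 ->
    on_table z' -> bounce t c z z' ->
    lax_ray z *m M = M *m lax_ray z0 -> \det M = 1 -> reduced d.+1 M ->
  reduced d (billiard_step t%:P c%:P 'X *m M).
Proof.
move=> [E0 h0 _] [E _ _] hz E' B I D r.
have [hh hz'] := heading_bounce E E' B.
have heading_neq0 : heading z0 != 0 by rewrite lt_eqF.
have I' := intertwine_trans (lax_ray_bounce E' B) I.
have {I} I0 := intertwine_trans (lax_flow _ _ _ t%:P) I.
rewrite -(laxU_bounce B) in I0.
(* [V1] is the diagonal entry between flight and bounce; the chord relation [hh] turns its leading
   coefficient into the opposite one. *)
set V1 := laxV z + _ in I0; have V1_2 : V1`_2 = - heading z0.
  rewrite /V1 coefD coefCM laxV_coef2 /laxW -polyCN !mul_polyC coefD !coefZ.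
  rewrite coefX coefXn /= -hz; apply: (lincomb (k := 1) hh); ring.
have size_V1 : (size V1 <= 3)%N.
  by apply: size_polyDleq; rewrite ?size_mulCleq ?size_laxV ?size_laxW.
move: D I0 I' r; rewrite (mx2E M).
move: (M 0 0) (M 0 1) (M 1 0) (M 1 1) => m11 m12 m21 m22.
rewrite det_mx2 reduced_mx2 => D I0 I' [s22 s12 s21].
rewrite (maxn_idPl _) // => s11.
pose n21 := m21 - t%:P * m11; pose n22 := m22 - t%:P * m12.
have eN : mx2 1 0 (- t%:P) 1 *m mx2 m11 m12 m21 m22 = mx2 m11 m12 n21 n22.
  by rewrite mulmx2 /n21 /n22; congr mx2; ring.
pose n11 := m11 + c%:P * ('X * n21); pose n12 := m12 + c%:P * ('X * n22).
have eN' : billiard_step t%:P c%:P 'X *m mx2 m11 m12 m21 m22 =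
    mx2 n11 n12 n21 n22.
  by rewrite mulmx2 /n11 /n12 /n21 /n22; congr mx2; ring.
rewrite eN in I0; rewrite eN' in I' *; rewrite reduced_mx2.
have D1 : m11 * n22 - m12 * n21 = 1 by rewrite /n21 /n22 -[RHS]D; ring.
have D2 : n11 * n22 - n12 * n21 = 1 by rewrite /n11 /n12 -[RHS]D1; ring.
have [en21 en22 en12] : [/\ n21 = m21 - t%:P * m11, n22 = m22 - t%:P * m12
    & n12 = m12 + c%:P * ('X * n22)] by [].
have en11 : n11 = m11 + c%:P * ('X * n21) by [].
clearbody n11 n12; clearbody n21 n22.
have m22E : m22 = n22 + t%:P * m12 by rewrite en22 subrK.
have s22' : (size n22 <= d.+2)%N by rewrite en22 size_polyBleq ?size_mulCleq ?s22.
have s21' : (size n21 <= d.+1)%N by rewrite en21 size_polyBleq ?size_mulCleq.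
have hV (p : {poly R}) y k : (size p <= k.+1)%N ->
    (laxV y * p)`_k.+2 = heading y * p`_k.
  by move=> hp; rewrite (coefM_top (i := 2) (j := k)) ?size_laxV ?laxV_coef2.
have hW (p : {poly R}) y k : (size p <= k)%N -> (laxW y * p)`_k.+2 = 0.
  by move=> hp; rewrite (coefM_gt (i := 2) (j := k)) ?size_laxW.
(* In degree [d + 3] of the lower right entry only the two products with V survive. Their leading
   coefficients are opposite, so the top coefficient of [n22] equals its own negative. *)
have top_n22 : n22`_d.+1 = 0.
  move: I0; rewrite !mulmx2 => /mx2_inj[_ _ _].
  move=> /(congr1 (fun p : {poly R} => p`_d.+3)).
  rewrite mulNr mulrN [n21 * _]mulrC [n22 * _]mulrC !coefD !coefN.
  rewrite (hV n22 z0 d.+1) // (hW n21) //.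
  rewrite (coefM_gt (i := 1) (j := d.+2)) ?size_laxU //.
  rewrite (coefM_top (i := 2) (j := d.+1)) // V1_2 => e.
  apply: (mulfI heading_neq0); lra.
have n22_le : (size n22 <= d.+1)%N by exact: size_le_coef.
(* The determinant has no term of degree [2 d + 1], and [m12] must have degree [d + 1], since
   otherwise [m22] would lose its own. *)
have n21_le : (size n21 <= d)%N.
  apply: size_le_coef => //.
  have := congr1 (fun p : {poly R} => p`_(d.+1 + d)) D1.
  rewrite /= coefB (coefM_gt (i := d) (j := d.+1)) 1?addnC //.
  rewrite (coefM_top (i := d.+1) (j := d)) 1?addnC // coef1 sub0r => /eqP.
  rewrite oppr_eq0 mulf_eq0 => /orP[/eqP e|/eqP //].
  have := coef_size s22; rewrite m22E coefD top_n22.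
  by rewrite coefCM e mulr0 addr0 eqxx.
have n12_le : (size n12 <= d.+2)%N.
  by rewrite en12 size_polyDleq ?size_mulCleq ?size_mulXleq.
have n11_le : (size n11 <= d.+1)%N.
  by rewrite en11 size_polyDleq ?size_mulCleq ?size_mulXleq.
(* The same sign clash, now after the bounce and in the upper right entry. *)
have top_n12 : n12`_d.+1 = 0.
  move: I'; rewrite !mulmx2 => /mx2_inj[_ + _ _].
  move=> /(congr1 (fun p : {poly R} => p`_d.+3)).
  rewrite mulrN [n11 * _]mulrC [n12 * _]mulrC !coefD !coefN.
  rewrite (hV n12 z' d.+1) // (hV n12 z0 d.+1) // (hW n22) // (hW n11) //.
  by rewrite hz' hz => e; apply: (mulfI heading_neq0); lra.
have top_n22' : n22`_d != 0.
  apply: contraTneq (coef_size s22) => e; rewrite negbK.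
  have e12 : m12`_d.+1 = 0.
    by move: top_n12; rewrite en12 coefD coefCM coefXM /= e mulr0 addr0.
  rewrite m22E coefD top_n22.
  by rewrite coefCM e12 mulr0 addr0.
have n12_le' : (size n12 <= d.+1)%N by exact: size_le_coef.
split=> //; first exact: size_eq_coef.
have [d0|d_gt0] := posnP d; first by rewrite d0 in n11_le *.
rewrite (maxn_idPl _) //; apply: size_le_coef => //.
(* For [d > 0] the determinant has no term of degree [2 d], which leaves the product of the top
   coefficients of [n11] and [n22]. *)
have := congr1 (fun p : {poly R} => p`_(d + d)) D2.
rewrite /= coefB (coefM_top (i := d) (j := d)) //.
rewrite (coefM_gt n12_le' n21_le) // coef1 subr0.
rewrite addn_eq0 eqn0Ngt d_gt0 => /eqP.
by rewrite mulf_eq0 (negPf top_n22') orbF => /eqP.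
Qed.

(** Here M is constant and upper triangular. At [s = 0] the entry U is 1 and V is 0, so constant
    terms in the first column force M to be scalar. *)
Lemma reduced0 z0 z M : on_table z0 -> on_table z ->
  lax_ray z *m M = M *m lax_ray z0 -> \det M = 1 -> reduced 0 M ->
  lax_ray z = lax_ray z0.
Proof.
move=> E0 E; rewrite (mx2E M).
move: (M 0 0) (M 0 1) (M 1 0) (M 1 1) => m11 m12 m21 m22.
rewrite reduced_mx2 det_mx2 => I D [/eqP/size_poly1P[k k_neq0 e22]].
move=> /size1_polyC e12 + /size1_polyC e11.
rewrite leqn0 size_poly_eq0 => /eqP e21.
move: I D; rewrite e22 e12 e21 e11 mulr0 subr0 -polyCM !mulmx2.
move: (m11`_0) (m12`_0) => f g {e22 e12 e21 e11} /mx2_inj.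
move=> [e11 e12 e21 _] _.
rewrite mulr0 addr0 in e11; rewrite mulr0 addr0 mul0r add0r in e21.
have fk : f = k.
  have := congr1 (fun p : {poly R} => p`_0) e21.
  by rewrite coefMC coefCM !laxU_coef0 mul1r mulr1.
have g0 : g = 0.
  have := congr1 (fun p : {poly R} => p`_0) e11.
  rewrite coefMC laxV_coef0 coefD !coefCM laxU_coef0 laxV_coef0.
  by rewrite mul0r mulr0 add0r mulr1.
have kP : k%:P != 0 :> {poly R} by rewrite polyC_eq0.
move: e11 e12 e21; rewrite fk g0 !mul0r !mulr0 !addr0 add0r ?[_ * k%:P]mulrC.
by move=> /(mulfI kP) eV /(mulfI kP) eW /(mulfI kP) eU; rewrite /lax_ray eU eV eW.
Qed.

(** * From the Pell equation to periodicity *)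

Definition pell_quartic : {poly R} :=
  'X * ('X - (a^-1)%:P) * ('X - (b^-1)%:P) * ('X - (l0^-1)%:P).

Lemma det_lax_quartic z : launched z ->
  laxV z ^+ 2 + laxU z * laxW z = (heading z ^+ 2)%:P * pell_quartic.
Proof.
case=> E _ T; rewrite det_lax_ray // (heading_sqr E T).
have inv x : x != 0 -> x%:P * 'X - 1 = x%:P * ('X - (x^-1)%:P) :> {poly R}.
  by move=> x0; rewrite mulrBr -polyCM mulfV.
by rewrite !inv // ?lt0r_neq0 // /pell_quartic; ring.
Qed.

Lemma size_pell_quartic : size pell_quartic = 5.
Proof.
rewrite /pell_quartic !size_Mmonic ?mulf_neq0 ?polyX_eq0 ?polyXsubC_eq0
  ?monicXsubC //.
by rewrite size_polyX !size_XsubC.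
Qed.

Lemma monic_pell_quartic : pell_quartic \is monic.
Proof. by rewrite /pell_quartic !rpredM ?monicX ?monicXsubC. Qed.

Definition pell p q := p ^+ 2 - pell_quartic * q ^+ 2 = 1.

Lemma pell_lead p q m : size p = m.+3 -> size q = m.+1 -> pell p q ->
  p`_m.+2 ^+ 2 = q`_m ^+ 2.
Proof.
move=> sp sq P.
have eP : p ^+ 2 = pell_quartic * q ^+ 2 + 1 by rewrite -P addrC subrK.
have q0 : q != 0 by rewrite -size_poly_eq0 sq.
have := congr1 lead_coef eP.
rewrite lead_coefDl; last first.
  rewrite size_poly1 size_monicM ?monic_pell_quartic ?expf_neq0 //.
  by rewrite size_pell_quartic addSn.
by rewrite lead_coef_exp lead_coef_monicM ?monic_pell_quartic // lead_coef_exp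
  !lead_coefE sp sq.
Qed.

Lemma pell_reduced z p q m : launched z ->
    size p = m.+3 -> size q = m.+1 -> pell p q ->
  exists M, [/\ lax_ray z *m M = M *m lax_ray z, \det M = 1 & reduced m.+2 M].
Proof.
move=> L sp sq P; have [E h _] := L.
have h0 : heading z != 0 by rewrite lt_eqF.
(* The size of [e] turns the determinant into the Pell expression. Its sign makes the leading terms
   of [p] and [q0 * laxV z] cancel in the upper left entry and add up in the lower right one. *)
have [e [e2 ep]] : exists e, e ^+ 2 * heading z ^+ 2 = 1 /\
    p`_m.+2 = e * heading z * q`_m.
  have /eqP := pell_lead sp sq P; rewrite eqf_sqr => /orP[/eqP->|/eqP->].
    by exists (heading z)^-1; rewrite -exprMn mulVf // expr1n mul1r.
  by exists (- (heading z)^-1); rewrite -exprMn mulNr mulVf // sqrrN expr1n mulN1r.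
pose q0 := e%:P * q.
have sq0 : (size q0 <= m.+1)%N by rewrite size_mulCleq ?sq.
have q0m : q0`_m = e * q`_m by rewrite coefCM.
have dM : p ^+ 2 - q0 ^+ 2 * (laxV z ^+ 2 + laxU z * laxW z) = 1.
  rewrite det_lax_quartic // -[RHS]P; apply: (lincomb
    (k := - (pell_quartic * q ^+ 2)) (congr1 polyC e2)).
  by rewrite /q0; ring.
have V_le : (size (q0 * laxV z)%R <= m.+3)%N.
  by rewrite (size_polyMtop (i := m) (j := 2)) ?addn2 ?size_laxV.
have V_top : (q0 * laxV z)`_m.+2 = p`_m.+2.
  rewrite (coefM_top (i := m) (j := 2)) ?addn2 ?size_laxV // laxV_coef2 q0m ep.
  by ring.
exists (mx2 (p - q0 * laxV z) (- (q0 * laxW z)) (- (q0 * laxU z))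
          (p + q0 * laxV z)); split.
- by rewrite !mulmx2; congr mx2; ring.
- by rewrite det_mx2 -[RHS]dM; ring.
apply/reduced_mx2; rewrite !size_polyN; split.
- apply: size_eq_coef; first by rewrite size_polyDleq ?sp.
  by rewrite coefD V_top -mulr2n mulrn_eq0 coef_size.
- by rewrite (size_polyMtop (i := m) (j := 2)) ?addn2 ?size_laxW.
- by rewrite (size_polyMtop (i := m) (j := 1)) ?addn1 ?size_laxU.
rewrite (maxn_idPl _) //; apply: size_le_coef; first by rewrite size_polyBleq ?sp.
by rewrite coefB V_top subrr.
Qed.

Implicit Types (zs : nat -> ray) (ts cs : nat -> R).

Definition orbit zs ts cs :=
  launched (zs 0%N) /\
  forall k, on_table (zs k) /\ bounce (ts k) (cs k) (zs k) (zs k.+1).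

Lemma orbit_launched zs ts cs k : orbit zs ts cs ->
  [/\ launched (zs k), heading (zs k) = heading (zs 0%N)
    & energy (zs k) = energy (zs 0%N)].
Proof.
case=> L H; elim: k => [//|k [Lk hk ek]].
have [[E B] [E' _]] := (H k, H k.+1).
have [_ hk'] := heading_bounce E E' B.
have [ek' _ _ _ _] := bounce_scalars E' B.
by split; [apply: launched_bounce B|rewrite hk'|rewrite ek'].
Qed.

Lemma pell_periodic zs ts cs p q m : orbit zs ts cs ->
    size p = m.+3 -> size q = m.+1 -> pell p q ->
  lax_ray (zs m.+2) = lax_ray (zs 0%N).
Proof.
move=> O sp sq P; have [L H] := O; have [E0 _ _] := L.
have [M0 [I0 D0 r0]] := pell_reduced L sp sq P.
suff step k d : (k + d = m.+2)%N -> exists M,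
    [/\ lax_ray (zs k) *m M = M *m lax_ray (zs 0%N), \det M = 1 & reduced d M].
  have [M [I D r]] := step m.+2 0%N (addn0 _).
  by apply: reduced0 r => //; have [] := H m.+2.
elim: k d => [|k IH] d; first by rewrite add0n => ->; exists M0.
rewrite addSnnS => /IH[M [I D r]].
have [[E B] [E' _]] := (H k, H k.+1).
have [Lk hk _] := orbit_launched k O.
exists (billiard_step (ts k)%:P (cs k)%:P 'X *m M); split.
- exact: intertwine_trans (lax_ray_bounce E' B) I.
- by rewrite det_mulmx D mulr1 det_mx2; ring.
exact: reduced_step L Lk hk E' B I D r.
Qed.

(** * From periodicity to the Pell equation *)

Lemma bounce_neq0 z z' t c : launched z -> on_table z' -> bounce t c z z' ->
  c != 0.
Proof.
move=> [E h _] E' B; have [e _] := heading_bounce E E' B.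
have [_ _ _ e3 _] := bounce_scalars E' B.
case: B => _ ex ey _ _; apply: contraTneq h => c0.
(* Without deflection the heading on arrival, which is [- heading z], would vanish. *)
suff -> : heading z = 0 by rewrite ltxx.
move: e e3; rewrite c0 ex ey /heading /scaled_energy; lra.
Qed.

(** Each step multiplies the leading coefficient of the upper left entry by [- ts k * cs k], which
    is nonzero, so its degree is exactly [k]. *)
Lemma monodromy zs ts cs k : orbit zs ts cs -> exists m11 m12 m21 m22,
  [/\ lax_ray (zs k) *m mx2 m11 m12 m21 m22 =
        mx2 m11 m12 m21 m22 *m lax_ray (zs 0%N),
      \det (mx2 m11 m12 m21 m22) = 1, size m11 = k.+1,
      (size m12 <= k.+1)%N /\ (size m21 <= k)%N & (size m22 <= maxn k 1)%N].
Proof.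
move=> O; have [L H] := O.
elim: k => [|k [m11 [m12 [m21 [m22 [I D s11 [s12 s21] s22]]]]]].
  exists 1, 0, 0, 1; rewrite !mulmx2 det_mx2 size_poly1 size_poly0.
  by split=> //; [congr mx2|]; ring.
have [[E B] [E' _]] := (H k, H k.+1).
have [Lk _ _] := orbit_launched k O.
have c0 := bounce_neq0 Lk E' B; have t0 : ts k != 0 by case: B => /lt0r_neq0.
have := intertwine_trans (lax_ray_bounce E' B) I.
have : \det (billiard_step (ts k)%:P (cs k)%:P 'X *m mx2 m11 m12 m21 m22) = 1.
  by rewrite det_mulmx D mulr1 det_mx2; ring.
pose n21 := m21 - (ts k)%:P * m11; pose n22 := m22 - (ts k)%:P * m12.
pose n11 := m11 + (cs k)%:P * ('X * n21).
pose n12 := m12 + (cs k)%:P * ('X * n22).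
have -> : billiard_step (ts k)%:P (cs k)%:P 'X *m mx2 m11 m12 m21 m22 =
    mx2 n11 n12 n21 n22.
  by rewrite mulmx2 /n11 /n12 /n21 /n22; congr mx2; ring.
have s21' : (size n21 <= k.+1)%N.
  by rewrite size_polyBleq ?size_mulCleq ?s11 // ltnW.
have s22' : (size n22 <= k.+1)%N.
  rewrite size_polyBleq ?size_mulCleq // (leq_trans s22) // geq_max.
  by rewrite leqnSn.
move=> D' I'; exists n11, n12, n21, n22; have s12' : (size n12 <= k.+2)%N.
  by rewrite size_polyDleq ?size_mulCleq ?size_mulXleq // ltnW.
rewrite (maxn_idPl _) //; split=> //.
apply: size_eq_coef.
  by rewrite size_polyDleq ?size_mulCleq ?size_mulXleq ?s11.
rewrite /n11 /n21 coefD coefCM coefXM /= coefB coefCM.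
rewrite [m11`_k.+1]nth_default ?s11 // [m21`_k]nth_default // !sub0r add0r.
by rewrite mulf_neq0 // oppr_eq0 mulf_neq0 // coef_size.
Qed.

(** At a common root [<p,p>_l = 1] and [<p,d>_l = <d,d>_l = 0]. A nondegenerate form then forces
    [d = 0]. In the cases [al = 0] and [be = 0] the ray lies on a coordinate axis, and tangency
    would give [l0 = b] or [l0 = a]. *)
Lemma lax_no_common_root z s : launched z ->
  (laxU z).[s] = 0 -> (laxV z).[s] = 0 -> (laxW z).[s] = 0 -> False.
Proof.
move=> L; have K := launched_energy L; case: L => E _ T.
rewrite /laxU /laxV /laxW.
rewrite !(hornerD, hornerN, hornerM, hornerXn, hornerX, hornerC) => eU eV eW.
have s0 : s != 0.
  apply/eqP => s0; move: eU; rewrite s0 expr2 !mulr0 !addr0 => /eqP;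
    by rewrite oner_eq0.
move: E T K eU eV eW.
rewrite /on_table /tangent_ray /heading /scaled_energy /cross /energy.
case: z => x y u v /= E T K eU eV eW.
pose al := b * s - 1; pose be := a * s - 1.
have hU : s * (x ^+ 2 * al + y ^+ 2 * be) = al * be.
  by apply: (lincomb (k := -1) eU); rewrite /al /be; ring.
have hV : x * u * al + y * v * be = 0.
  by apply: (mulfI s0); apply: (lincomb (k := 1) eV); rewrite /al /be; ring.
have hW : u ^+ 2 * al + v ^+ 2 * be = 0.
  by apply: (mulfI s0); apply: (lincomb (k := 1) eW); rewrite /al /be; ring.
have hab : be - al != 0.
  have -> : be - al = (a - b) * s by rewrite /al /be; ring.
  by rewrite mulf_neq0 // subr_eq0 gt_eqF.
clearbody al be.
have [al0|al0] := eqVneq al 0.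
  rewrite al0 subr0 in hab; move: hU hW; rewrite al0 mul0r !mulr0 !add0r.
  move=> /eqP + /eqP; rewrite !mulf_eq0 (negPf s0) (negPf hab) !orbF /=.
  rewrite !orbb => /eqP y0 /eqP v0.
  have /eqP : (b - l0) * u ^+ 2 = 0 by move: T; rewrite y0 v0; lra.
  rewrite v0 expr0n addr0 in K; rewrite mulf_eq0 (gt_eqF K) orbF.
  by case: l0_caustic => -[h1 h2] /eqP; lra.
have [be0|be0] := eqVneq be 0.
  move: hU hW; rewrite be0 !mulr0 !addr0.
  move=> /eqP + /eqP; rewrite !mulf_eq0 (negPf s0) (negPf al0) !orbF /=.
  rewrite !orbb => /eqP x0 /eqP u0.
  have /eqP : (a - l0) * v ^+ 2 = 0 by move: T; rewrite x0 u0; lra.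
  rewrite u0 expr0n add0r in K; rewrite mulf_eq0 (gt_eqF K) orbF.
  by have := b_lt_a; case: l0_caustic => -[h1 h2] + /eqP; lra.
have cr : x * v - y * u = 0.
  apply/eqP; rewrite -sqrf_eq0; apply/eqP.
  apply: (mulfI (mulf_neq0 al0 be0)).
  apply: (lincomb2 (k := x ^+ 2 * al + y ^+ 2 * be)
                   (l := - (x * u * al + y * v * be)) hW hV); ring.
have u0 : u = 0.
  apply: (mulfI (mulf_neq0 al0 be0)); rewrite mulr0 -hU.
  by apply: (lincomb2 (k := s * x) (l := - s * y * be) hV cr); ring.
have v0 : v = 0.
  apply: (mulfI (mulf_neq0 al0 be0)); rewrite mulr0 -hU.
  by apply: (lincomb2 (k := s * y) (l := s * x * al) hV cr); ring.
by move: K; rewrite u0 v0 expr0n addr0 ltxx.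
Qed.

(** The quotient of [m21] by [laxU z] is a polynomial: at the only root of [laxU z] one of V and W
    is nonzero, and the commutation relations then make [m21] vanish there. *)
Lemma lax_commutant z m11 m12 m21 m22 : launched z ->
    lax_ray z *m mx2 m11 m12 m21 m22 = mx2 m11 m12 m21 m22 *m lax_ray z ->
  exists q, [/\ m11 - m22 = 2 * q * laxV z, m12 = q * laxW z
              & m21 = q * laxU z].
Proof.
move=> L; have [E _ _] := L; rewrite !mulmx2 => /mx2_inj[e11 _ e21 _].
have {}e11 : m12 * laxU z = laxW z * m21 by apply: (lincomb (k := -1) e11); ring.
have {}e21 : laxU z * (m11 - m22) = 2 * laxV z * m21.
  by apply: (lincomb (k := 1) e21); ring.
(* The ellipse does not meet its director circle [x^2 + y^2 = a + b], so [laxU z] has degree exactly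
   1. *)
have U1_neq0 : rx z ^+ 2 + ry z ^+ 2 - a - b != 0.
  apply/eqP => e; have : 0 < (a - b) * ry z ^+ 2 + b ^+ 2.
    by rewrite ltr_wpDl ?exprn_gt0 // mulr_ge0 ?sqr_ge0 // subr_ge0 ltW.
  suff -> : (a - b) * ry z ^+ 2 + b ^+ 2 = 0 by rewrite ltxx.
  by apply: (lincomb2 (k := 1) (l := - b) E e); ring.
pose s := - (rx z ^+ 2 + ry z ^+ 2 - a - b)^-1.
have eU : laxU z = (rx z ^+ 2 + ry z ^+ 2 - a - b)%:P * ('X - s%:P).
  by rewrite laxU_on_table // mulrBr -polyCM /s mulrN mulfV // polyCN opprK addrC.
have Us : (laxU z).[s] = 0 by rewrite eU !hornerE subrr mulr0.
have U_neq0 : laxU z != 0 by rewrite eU mulf_neq0 ?polyC_eq0 ?polyXsubC_eq0.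
have /factor_theorem[q1 eq1] : root m21 s.
  apply/rootP/eqP; apply/negPn/negP => m21s.
  apply: (lax_no_common_root L Us); apply: (mulIf m21s).
    have := congr1 (horner^~ s) e21; rewrite !hornerM Us !mul0r -mulrA => /esym/eqP.
    by rewrite mulf_eq0 -polyC_natr hornerC pnatr_eq0 /= => /eqP.
  by have := congr1 (horner^~ s) e11; rewrite !hornerM Us mulr0 mul0r => <-.
pose q := q1 * (rx z ^+ 2 + ry z ^+ 2 - a - b)^-1%:P.
have e : m21 = q * laxU z.
  by rewrite eU /q mulrA -[q1 * _ * _]mulrA -polyCM mulVf // mulr1.
exists q; split=> //; apply: (mulfI U_neq0).
  by rewrite e21 e; ring.
by rewrite mulrC e11 e; ring.
Qed.

Lemma periodic_pell zs ts cs m : orbit zs ts cs ->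
    lax_ray (zs m.+2) = lax_ray (zs 0%N) ->
  exists p q, [/\ size p = m.+3, size q = m.+1 & pell p q].
Proof.
move=> O; have [L _] := O.
have [m11 [m12 [m21 [m22 [I D s11 _ s22]]]]] := monodromy m.+2 O.
move=> eL; rewrite eL in I; have [q0 [e1 e2 e3]] := lax_commutant L I.
rewrite (maxn_idPl _) // in s22.
(* [p] is half the trace, and inherits its degree from [m11] because [m22] has a smaller one. The
   factor in [q] absorbs the constant in [det_lax_quartic]. *)
pose p := (2^-1)%:P * (m11 + m22); pose q := (heading (zs 0%N))%:P * q0.
have two : (2^-1)%:P * 2 = 1 :> {poly R}.
  by rewrite -polyC_natr -polyCM mulVf ?pnatr_eq0.
have P : pell p q.
  have {}D : m11 * m22 - q0 ^+ 2 * (laxU (zs 0%N) * laxW (zs 0%N)) = 1.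
    by rewrite -[RHS]D det_mx2 e2 e3; ring.
  rewrite /pell; transitivity (p ^+ 2 - q0 ^+ 2 *
      ((heading (zs 0%N) ^+ 2)%:P * pell_quartic)); first by rewrite /q; ring.
  rewrite -det_lax_quartic // -[RHS]D.
  have e4 : q0 * laxV (zs 0%N) = (2^-1)%:P * (m11 - m22).
    by rewrite e1 !mulrA two mul1r.
  have e5 : q0 ^+ 2 * laxV (zs 0%N) ^+ 2 = ((2^-1)%:P * (m11 - m22)) ^+ 2.
    by rewrite -e4 exprMn.
  apply: (lincomb2 (k := ((2^-1)%:P * 2 + 1) * m11 * m22) (l := -1) two e5).
  by rewrite /p; ring.
have sp : size p = m.+3.
  rewrite /p size_Cmul ?invr_eq0 ?pnatr_eq0 //.
  by rewrite size_polyDl s11.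
have p_neq0 : p != 0 by rewrite -size_poly_eq0 sp.
have q_neq0 : q != 0.
  apply/eqP => q0_; have := congr1 (size : {poly R} -> nat) P.
  by rewrite q0_ expr0n mulr0 subr0 expr2 size_mul // sp size_poly1 addnS.
exists p, q; split=> //.
(* The degree of [q] is read off from the equation: [2 deg p = 4 + 2 deg q]. *)
have eP : p ^+ 2 = pell_quartic * q ^+ 2 + 1 by rewrite -P addrC subrK.
have sPq : size (pell_quartic * q ^+ 2) = (size q + size q).+3.
  rewrite size_monicM ?monic_pell_quartic ?expf_neq0 // size_pell_quartic expr2.
  rewrite size_mul // -subn1; move: q_neq0; rewrite -size_poly_gt0.
  by case: (size q) => // k _; rewrite !addSn subn1.
have := congr1 (size : {poly R} -> nat) eP.
rewrite size_polyDl sPq ?size_poly1 // expr2 size_mul // sp.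
by move: (size q); clear=> k; lia.
Qed.

(** * Billiard trajectories with a caustic as orbits of rays *)

Lemma l0_neq : l0 != a /\ l0 != b.
Proof.
case: l0_caustic => -[h1 h2]; first by rewrite !lt_eqF // (lt_trans h2).
by rewrite lt_eqF // gt_eqF.
Qed.

Definition ray_of (p w : 'rV[R]_2) :=
  Ray (xcoord p) (ycoord p) (xcoord w) (ycoord w).

(** The condition is [S = cross^2], with [S] the cleared form [<d,d>_l0]. If [S] is nonzero, contact
    occurs where the position is conjugate to [d]; if [S = 0], the line passes through the center in
    an isotropic direction and is an asymptote. *)
Lemma line_tangentP (p q : 'rV[R]_2) : p != q ->
  line_tangent a b l0 p q <-> tangent_ray (ray_of p (q - p)).
Proof.
move=> pq; have [la lb] := l0_neq.
have A0 : a - l0 != 0 by rewrite subr_eq0 eq_sym.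
have B0 : b - l0 != 0 by rewrite subr_eq0 eq_sym.
have AB0 := mulf_neq0 A0 B0.
rewrite /line_tangent /tangent_at_point /asymptote.
rewrite /tangent_ray /scaled_energy /cross /energy /=.
set u := xcoord (q - p); set v := ycoord (q - p).
set x := xcoord p; set y := ycoord p.
have uv : u != 0 \/ v != 0 by apply: coord_neq0; rewrite subr_eq0 eq_sym.
have ex t : xcoord (line_point p q t) = x + t * u by rewrite xcoord_line -xcoordB.
have ey t : ycoord (line_point p q t) = y + t * v by rewrite ycoord_line -ycoordB.
split=> [[[t [/(on_conicP b_lt_a)]]|[[t t0]]]|T].
- rewrite dotE conic_normalE xcoord_point ycoord_point ex ey -/u -/v => e1 e2.
  have {}e2 : (x + t * u) * u * (b - l0) + (y + t * v) * v * (a - l0) = 0.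
    by apply: (lincomb (k := (a - l0) * (b - l0)) e2); field; rewrite A0 B0.
  apply: (mulfI AB0).
  apply: (lincomb2 (k := b * u ^+ 2 + a * v ^+ 2 - l0 * (u ^+ 2 + v ^+ 2))
    (l := (x + t * u) * u * (b - l0) + (y + t * v) * v * (a - l0)) e1 e2).
  by ring.
- have := ex t; have := ey t; rewrite t0 /xcoord /ycoord !mxE => ey0 ex0 e.
  have {}e : u ^+ 2 * (b - l0) + v ^+ 2 * (a - l0) = 0.
    by apply: (lincomb (k := (a - l0) * (b - l0)) e); field; rewrite A0 B0.
  have cr : x * v - y * u = 0.
    by apply: (lincomb2 (k := - v) (l := u) ex0 ey0); ring.
  rewrite cr; apply: (lincomb (k := 1) e); ring.
pose S := u ^+ 2 * (b - l0) + v ^+ 2 * (a - l0).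
have ST : S = (x * v - y * u) ^+ 2.
  by apply: (lincomb (k := 1) T); rewrite /S; ring.
have [S0|S0] := eqVneq S 0; [right|left].
  have cr : x * v - y * u = 0 by apply/eqP; rewrite -sqrf_eq0 -ST S0.
  split; last first.
    by apply: (lincomb (k := ((a - l0) * (b - l0))^-1) S0);
      rewrite /S; field; rewrite A0 B0.
  case: uv => [u0|v0].
    exists (- x / u); apply: coord_eq; rewrite ?ex ?ey /xcoord /ycoord mxE.
      by field.
    by apply: (lincomb (k := - u^-1) cr); field.
  exists (- y / v); apply: coord_eq; rewrite ?ex ?ey /xcoord /ycoord mxE.
    by apply: (lincomb (k := v^-1) cr); field.
  by field.
pose t := - (x * u * (b - l0) + y * v * (a - l0)) / S.
have e : (x + t * u) * u * (b - l0) + (y + t * v) * v * (a - l0) = 0.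
  have tS : t * S = - (x * u * (b - l0) + y * v * (a - l0)) by rewrite divfK.
  by apply: (lincomb (k := 1) tS); rewrite /S; ring.
exists t; split.
  apply/(on_conicP b_lt_a); rewrite ex ey; apply: (mulfI S0).
  apply: (lincomb2 (k := (a - l0) * (b - l0)) (l := - ((x + t * u) * u *
    (b - l0) + (y + t * v) * v * (a - l0))) ST e).
  by rewrite /S; ring.
rewrite dotE conic_normalE xcoord_point ycoord_point ex ey -/u -/v.
apply: (lincomb (k := ((a - l0) * (b - l0))^-1) e); field.
by rewrite A0 B0.
Qed.

Definition traces zs (P : nat -> 'rV[R]_2) :=
  forall k, xcoord (P k) = rx (zs k) /\ ycoord (P k) = ry (zs k).

Lemma scaled_energy_gt0 z : 0 < energy z -> 0 < scaled_energy z.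
Proof.
rewrite /energy /scaled_energy => K; apply: lt_le_trans (mulr_gt0 b_gt0 K) _.
by rewrite mulrDr lerD2l ler_wpM2r ?sqr_ge0 // ltW.
Qed.

(** The reflection law fixes an edge only up to a positive factor. [D] iterates the mirror from the
    first edge, keeping its length constant, and [ts] measures each edge against [D]. *)
Lemma trajectory_orbit (P : nat -> 'rV[R]_2) :
    billiard_trajectory a b P -> has_caustic a b l0 P ->
  exists zs ts cs, orbit zs ts cs /\ traces zs P.
Proof.
move=> T C; pose N k := conic_normal a b 0 (P k).
have NE k : N k = point (xcoord (P k) / a) (ycoord (P k) / b).
  by rewrite /N conic_normalE !subr0.
pose D := nat_rect (fun=> 'rV[R]_2) (P 1%N - P 0%N)
  (fun k d => mirror (N k.+1) d).
have step k : exists t, (0 < t) && (P k.+1 - P k == t *: D k).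
  elim: k => [|k [t /andP[t_gt0 /eqP e]]].
    by exists 1; rewrite ltr01 scale1r eqxx.
  have [_ _ [c [c_gt0 e']]] := T k; exists (c * t); rewrite mulr_gt0 //=.
  by rewrite e' e mirrorZ scalerA eqxx.
pose ts k := xchoose (step k); pose zs k := ray_of (P k) (D k).
pose cs k := 2 * dot (D k) (N k.+1) / dot (N k.+1) (N k.+1).
have on k : on_table (zs k) by have [/(on_ellipseP b_lt_a)] := T k.
have Bk k : bounce (ts k) (cs k) (zs k) (zs k.+1).
  have /andP[t_gt0 /eqP e] := xchooseP (step k).
  have N0 : dot (N k.+1) (N k.+1) != 0.
    by rewrite dotE NE xcoord_point ycoord_point -!expr2 (normal_neq0 (on k.+1)).
  split=> //=.
  - by have := congr1 (@xcoord R) e; rewrite xcoordB xcoordZ => <-; rewrite addrC subrK.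
  - by have := congr1 (@ycoord R) e; rewrite ycoordB ycoordZ => <-; rewrite addrC subrK.
  - rewrite /mirror xcoordB ycoordB xcoordZ ycoordZ NE.
    by rewrite xcoord_point ycoord_point -NE.
  have : cs k * dot (N k.+1) (N k.+1) = 2 * dot (D k) (N k.+1).
    by rewrite /cs divfK.
  rewrite !dotE NE xcoord_point ycoord_point => e1.
  by rewrite !expr2 e1.
exists zs, ts, cs; split=> //; split=> [|k]; last by split.
have [_ P01 _] := T 0%N.
have K : 0 < energy (zs 0%N).
  rewrite lt_def addr_ge0 ?sqr_ge0 // andbT paddr_eq0 ?sqr_ge0 // !sqrf_eq0.
  apply/negP => /andP[x0 y0].
  have : P 1%N - P 0%N != 0 by rewrite subr_eq0 eq_sym.
  by move=> /coord_neq0; rewrite x0 y0; case.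
split=> //; last by have /(line_tangentP P01) := C 0%N.
have [e _] := heading_bounce (on _) (on _) (Bk 0%N).
have : 0 < ts 0%N * scaled_energy (zs 0%N).
  by rewrite mulr_gt0 ?scaled_energy_gt0 //; case: (Bk 0%N).
move: e; move: (heading _) (_ * scaled_energy _) => h s; lra.
Qed.

(* The foci are the only points without elliptic coordinates. *)
Lemma tangent_avoids_foci z t : tangent_ray z -> 0 < energy z ->
  ry z + t * rv z != 0 \/ (rx z + t * ru z) ^+ 2 != a - b.
Proof.
move=> T K; have [y0|?] := eqVneq (ry z + t * rv z) 0; last by left.
right; apply/eqP => x2.
have cr : cross z = (rx z + t * ru z) * rv z.
  by apply: (lincomb (k := - ru z) y0); rewrite /cross; ring.
have /eqP : (b - l0) * energy z = 0.
  move: T; rewrite /tangent_ray cr exprMn x2 => T.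
  by apply: (lincomb (k := 1) T); rewrite /energy /scaled_energy; ring.
by rewrite mulf_eq0 (gt_eqF K) orbF subr_eq0 eq_sym (negPf (proj2 l0_neq)).
Qed.

(** * Lax matrices and elliptic coordinates *)

Lemma lax_ray_inj z z' : on_table z -> on_table z' -> lax_ray z = lax_ray z' ->
  [/\ rx z ^+ 2 = rx z' ^+ 2, rx z * ru z = rx z' * ru z' & ru z ^+ 2 = ru z' ^+ 2] /\
  [/\ ry z ^+ 2 = ry z' ^+ 2, ry z * rv z = ry z' * rv z' & rv z ^+ 2 = rv z' ^+ 2].
Proof.
move=> E E' /mx2_inj[eV eW eU _].
have U1 : rx z ^+ 2 + ry z ^+ 2 = rx z' ^+ 2 + ry z' ^+ 2.
  have := congr1 (fun r : {poly R} => r`_1) eU; rewrite !laxU_on_table //.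
  by rewrite !mul_polyC !coefD !coefZ coef1 coefX /=; lra.
have V1 : rx z * ru z + ry z * rv z = rx z' * ru z' + ry z' * rv z'.
  have := congr1 (fun r : {poly R} => r`_1) eV; rewrite /laxV -!polyCN.
  by rewrite !mul_polyC !coefD !coefZ coefX coefXn /=; lra.
have V2 := congr1 (fun r : {poly R} => r`_2) eV; rewrite /= !laxV_coef2 in V2.
have W1 : energy z = energy z'.
  have := congr1 (fun r : {poly R} => r`_1) eW; rewrite /laxW -!polyCN.
  by rewrite !mul_polyC !coefD !coefZ coefX coefXn /=; lra.
have W2 : scaled_energy z = scaled_energy z'.
  have := congr1 (fun r : {poly R} => r`_2) eW; rewrite /laxW -!polyCN.
  by rewrite !mul_polyC !coefD !coefZ coefX coefXn /=; lra.
have {E'}E := etrans E (esym E').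
(* Positions, mixed products and directions each come with a plain and a weighted sum; for positions
   the weighted one is the table equation. *)
have solve X Y X' Y' : X + Y = X' + Y' -> b * X + a * Y = b * X' + a * Y' ->
    X = X' /\ Y = Y'.
  have /mulfI ab : a - b != 0 by rewrite subr_eq0 gt_eqF.
  move=> e1 e2; split; apply: ab.
    by apply: (lincomb2 (k := a) (l := -1) e1 e2); ring.
  by apply: (lincomb2 (k := - b) (l := 1) e1 e2); ring.
have [x2 y2] := solve _ _ _ _ U1 E.
rewrite /heading -!mulrA in V2; have [xu yv] := solve _ _ _ _ V1 V2.
by have [u2 v2] := solve _ _ _ _ W1 W2.
Qed.

Lemma lax_ray_eq z z' :
  [/\ rx z ^+ 2 = rx z' ^+ 2, rx z * ru z = rx z' * ru z' & ru z ^+ 2 = ru z' ^+ 2] ->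
  [/\ ry z ^+ 2 = ry z' ^+ 2, ry z * rv z = ry z' * rv z' & rv z ^+ 2 = rv z' ^+ 2] ->
  lax_ray z = lax_ray z'.
Proof.
move=> [x2 xu u2] [y2 yv v2]; rewrite /lax_ray /laxU /laxV /laxW /heading /energy.
by rewrite /scaled_energy -!mulrA x2 xu u2 y2 yv v2.
Qed.

Lemma line_point_orbit zs ts cs P k t : orbit zs ts cs -> traces zs P ->
  let p := line_point (P k) (P k.+1) t in
  xcoord p = rx (zs k) + t * ts k * ru (zs k) /\
  ycoord p = ry (zs k) + t * ts k * rv (zs k).
Proof.
move=> [_ H] tr /=; rewrite xcoord_line ycoord_line.
have [[-> ->] [-> ->]] := (tr k, tr k.+1); have [_ [_ -> -> _ _]] := H k.
by split; ring.
Qed.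

Lemma sqr_line x e x' e' t : x ^+ 2 = x' ^+ 2 -> x * e = x' * e' ->
  e ^+ 2 = e' ^+ 2 -> (x + t * e) ^+ 2 = (x' + t * e') ^+ 2.
Proof.
move=> x2 xe e2.
have sq u v :
    (u + t * v) ^+ 2 = u ^+ 2 + 2 * t * (u * v) + t ^+ 2 * v ^+ 2 by ring.
by rewrite !sq x2 xe e2.
Qed.

(** A quadratic in [t] is determined by its values at 0, 1/2 and 1. *)
Lemma sqr_line_inv x e x' e' :
  (forall t, 0 <= t <= 1 -> (x + t * e) ^+ 2 = (x' + t * e') ^+ 2) ->
  [/\ x ^+ 2 = x' ^+ 2, x * e = x' * e' & e ^+ 2 = e' ^+ 2].
Proof.
move=> H; have h0 : x ^+ 2 = x' ^+ 2.
  by have := H 0; rewrite !mul0r !addr0; apply; rewrite lexx ler01.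
have h1 : (x + e) ^+ 2 = (x' + e') ^+ 2.
  by have := H 1; rewrite !mul1r; apply; rewrite lexx ler01.
have h2 : (2 * x + e) ^+ 2 = (2 * x' + e') ^+ 2.
  have half : 0 <= (2^-1 : R) <= 1 by lra.
  have two u v : 2 * u + v = 2 * (u + 2^-1 * v) :> R by field.
  by rewrite !two !exprMn (H _ half).
by split=> //; lra.
Qed.

(** Equal Lax matrices mean rays equal up to reflections in the axes, with equal chord lengths by
    the chord relation. Squared coordinates therefore agree along the edges, and a tangent of the
    caustic misses the foci. *)
Lemma lax_elliptic_periodic zs ts cs P n : orbit zs ts cs -> traces zs P ->
    (forall k, lax_ray (zs (k + n)%N) = lax_ray (zs k)) ->
  elliptic_periodic a b n P.
Proof.
move=> O tr per k t _; have [L _ _] := orbit_launched k O.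
have K := launched_energy L; have [E _ T] := L.
have [[E' _ _] _ _] := orbit_launched (k + n) O.
have [[x2 xu u2] [y2 yv v2]] := lax_ray_inj E' E (per k).
have len i : 2 * heading (zs i) + ts i * scaled_energy (zs i) = 0.
  have [_ H] := O; have [[Ei B] [Ei' _]] := (H i, H i.+1).
  by have [] := heading_bounce Ei Ei' B.
have et : ts (k + n)%N = ts k.
  have S := scaled_energy_gt0 K; apply: (mulIf (lt0r_neq0 S)).
  have := len (k + n)%N; have := len k; rewrite /heading /scaled_energy.
  rewrite -!mulrA xu yv u2 v2; lra.
have [ex ey] := line_point_orbit k t O tr.
have [ex' ey'] := line_point_orbit (k + n) t O tr.
have [l1 [l2 l12]] : exists l1 l2,
    elliptic_coordinates a b (line_point (P k) (P k.+1) t) l1 l2.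
  by apply: elliptic_coordinates_exist => //; rewrite ex ey;
    apply: tangent_avoids_foci.
exists l1, l2; split=> //; apply: (elliptic_coordinates_eq_sqr _ _ _ l12) => //.
  by rewrite ex ex' et; apply/esym/sqr_line.
by rewrite ey ey' et; apply/esym/sqr_line.
Qed.

(** Elliptic coordinates along an edge determine the squared components of the vector [t d].
    Conservation of energy separates [t] from [d]. *)
Lemma elliptic_periodic_lax zs ts cs P n : orbit zs ts cs -> traces zs P ->
  elliptic_periodic a b n P -> lax_ray (zs n) = lax_ray (zs 0%N).
Proof.
move=> O tr per; have [L H] := O; have K := launched_energy L.
have [_ _ K'] := orbit_launched n O.
have sq t : 0 <= t <= 1 ->
    (rx (zs n) + t * (ts n * ru (zs n))) ^+ 2 =
    (rx (zs 0%N) + t * (ts 0%N * ru (zs 0%N))) ^+ 2 /\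
    (ry (zs n) + t * (ts n * rv (zs n))) ^+ 2 =
    (ry (zs 0%N) + t * (ts 0%N * rv (zs 0%N))) ^+ 2.
  move=> /(per 0%N)[l1 [l2 [e1 e2]]]; rewrite add0n in e2.
  have [ex ey] := line_point_orbit 0 t O tr.
  have [ex' ey'] := line_point_orbit n t O tr.
  by rewrite !mulrA -ex -ey -ex' -ey'; apply: elliptic_coordinates_sqr e2 e1.
have [x2 xu u2] := sqr_line_inv (fun t h => proj1 (sq t h)).
have [y2 yv v2] := sqr_line_inv (fun t h => proj2 (sq t h)).
have tn : 0 < ts n by have [_ []] := H n.
have t0 : 0 < ts 0%N by have [_ []] := H 0%N.
have et : ts n = ts 0%N.
  apply/eqP; rewrite -(eqrXn2 (ltn0Sn 1)) ?ltW //; apply/eqP.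
  apply: (mulIf (lt0r_neq0 K)); rewrite -[in LHS]K' /energy !mulrDr -!exprMn.
  by rewrite u2 v2.
have tI := mulfI (lt0r_neq0 t0); move: xu u2 yv v2; rewrite et !exprMn.
have t2I := mulfI (expf_neq0 2 (lt0r_neq0 t0)).
rewrite ![_ * (ts 0%N * _)]mulrCA => /tI xu /t2I u2 /tI yv /t2I v2.
exact: lax_ray_eq.
Qed.

Lemma orbit_shift zs ts cs k : orbit zs ts cs ->
  orbit (fun i => zs (k + i)%N) (fun i => ts (k + i)%N) (fun i => cs (k + i)%N).
Proof.
move=> O; split=> [|i]; first by rewrite addn0; have [] := orbit_launched k O.
by rewrite addnS; have [_] := O.
Qed.

(** * Existence of a trajectory with the given caustic *)

Definition next_length z := - 2 * heading z / scaled_energy z.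

Definition next_x z := rx z + next_length z * ru z.

Definition next_y z := ry z + next_length z * rv z.

Definition next_factor z :=
  2 * (ru z * (next_x z / a) + rv z * (next_y z / b)) /
  ((next_x z / a) ^+ 2 + (next_y z / b) ^+ 2).

Definition next_ray z :=
  Ray (next_x z) (next_y z) (ru z - next_factor z * (next_x z / a))
      (rv z - next_factor z * (next_y z / b)).

Lemma next_rayP z : launched z ->
  on_table (next_ray z) /\
  bounce (next_length z) (next_factor z) z (next_ray z).
Proof.
move=> L; have S := scaled_energy_gt0 (launched_energy L); have [E h _] := L.
(* [next_length z] is the nonzero root of the quadratic that puts the end of the chord on the
   table. *)
have lS : next_length z * scaled_energy z = - 2 * heading z.
  by rewrite divfK // lt0r_neq0.
have E' : on_table (next_ray z).
  apply: (lincomb2 (k := 1) (l := next_length z) E lS).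
  by rewrite /= /next_x /next_y /heading /scaled_energy; ring.
split=> //; split=> //.
  by rewrite divr_gt0 // mulNr oppr_gt0 pmulr_rlt0.
by rewrite divfK // (normal_neq0 E').
Qed.

(** The witness follows the tangent at a vertex of the caustic: the horizontal line
    [y = sqrt (b - l0)] for an ellipse, the vertical line [x = sqrt (a - l0)] for a hyperbola. *)
Lemma launched_exists : exists z, launched z.
Proof.
case: l0_caustic => -[h1 h2].
  exists (Ray (- Num.sqrt (a * l0 / b)) (Num.sqrt (b - l0)) 1 0).
  have s1 : Num.sqrt (a * l0 / b) ^+ 2 = a * l0 / b.
    by rewrite sqr_sqrtr // ltW // divr_gt0 // mulr_gt0.
  have s2 : Num.sqrt (b - l0) ^+ 2 = b - l0 by rewrite sqr_sqrtr // subr_ge0 ltW.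
  split; rewrite /on_table /tangent_ray /heading /scaled_energy /cross /energy /=.
  - by rewrite sqrrN s1 s2; field.
  - rewrite mulr1 mulr0 addr0 mulrN oppr_lt0 mulr_gt0 // sqrtr_gt0.
    by rewrite divr_gt0 // mulr_gt0.
  by apply: (lincomb (k := -1) s2); ring.
exists (Ray (Num.sqrt (a - l0)) (- Num.sqrt (b * l0 / a)) 0 1).
have s1 : Num.sqrt (b * l0 / a) ^+ 2 = b * l0 / a.
  by rewrite sqr_sqrtr // ltW // divr_gt0 // mulr_gt0.
have s2 : Num.sqrt (a - l0) ^+ 2 = a - l0 by rewrite sqr_sqrtr // subr_ge0 ltW.
split; rewrite /on_table /tangent_ray /heading /scaled_energy /cross /energy /=.
- by rewrite sqrrN s1 s2; field.
- rewrite mulr1 mulr0 add0r mulrN oppr_lt0 mulr_gt0 // sqrtr_gt0.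
  by rewrite divr_gt0 // mulr_gt0.
by apply: (lincomb (k := -1) s2); ring.
Qed.

Lemma orbit_exists : exists zs ts cs, orbit zs ts cs.
Proof.
have [z0 L0] := launched_exists; pose zs k := iter k next_ray z0.
have L k : launched (zs k).
  elim: k => [//|k Lk]; have [E' B] := next_rayP Lk.
  exact: launched_bounce Lk E' B.
exists zs, (next_length \o zs), (next_factor \o zs).
by split=> // k; split; [have [] := L k | have [] := next_rayP (L k)].
Qed.

Lemma orbit_trajectory zs ts cs : orbit zs ts cs ->
  let P k := point (rx (zs k)) (ry (zs k)) in
  [/\ traces zs P, billiard_trajectory a b P & has_caustic a b l0 P].
Proof.
move=> O P; have [_ H] := O.
have tr : traces zs P by move=> k; rewrite xcoord_point ycoord_point.
have edge k : P k.+1 - P k = ts k *: point (ru (zs k)) (rv (zs k)).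
  have [_ [_ ex ey _ _]] := H k.
  apply: coord_eq; rewrite ?xcoordB ?ycoordB ?xcoordZ ?ycoordZ.
    by rewrite !xcoord_point ex addrC addKr.
  by rewrite !ycoord_point ey addrC addKr.
have tgt0 k : 0 < ts k by have [_ []] := H k.
have neq k : P k != P k.+1.
  have [L _ _] := orbit_launched k O; have := launched_energy L.
  apply: contraTneq => e; have := edge k; rewrite e subrr => /esym/eqP.
  rewrite scaler_eq0 (gt_eqF (tgt0 k)) /= => /eqP d0.
  have u0 := congr1 (@xcoord R) d0; have v0 := congr1 (@ycoord R) d0.
  rewrite xcoord_point /xcoord mxE in u0; rewrite ycoord_point /ycoord mxE in v0.
  by rewrite /energy u0 v0 expr0n addr0 ltxx.
split=> // k.
  split=> //.
    apply/(on_ellipseP b_lt_a); rewrite xcoord_point ycoord_point.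
    by have [] := H k.
  exists (ts k.+1 / ts k); split; first by rewrite divr_gt0.
  rewrite !edge mirrorZ scalerA divfK ?lt0r_neq0 //; congr (_ *: _).
  have [_ [_ _ _ [eu ev] ec]] := H k.
  have [E' _] := H k.+1.
  rewrite /mirror !dotE conic_normalE !subr0 !xcoord_point !ycoord_point -!expr2.
  rewrite -ec (mulfK (normal_neq0 E')).
  by apply: coord_eq; rewrite ?xcoordB ?ycoordB ?xcoordZ ?ycoordZ
    ?xcoord_point ?ycoord_point.
apply/(line_tangentP (neq k)); rewrite edge.
have [[_ _ T] _ _] := orbit_launched k O.
move: T; rewrite /tangent_ray /scaled_energy /cross /energy /= !xcoordZ !ycoordZ.
rewrite !xcoord_point !ycoord_point => T.
by apply: (lincomb (k := ts k ^+ 2) T); ring.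
Qed.
End Rays.

Theorem corollary3p4 (R : realType) (a b l0 : R) (n : nat)
    (hb : 0 < b) (hab : b < a)
    (hl0 : (0 < l0 /\ l0 < b) \/ (b < l0 /\ l0 < a))
    (hn : (2 <= n)%N) :
  (forall P : nat -> 'rV[R]_2,
      billiard_trajectory a b P -> has_caustic a b l0 P ->
      elliptic_periodic a b n P)
  <->
  (exists p q : {poly R},
      [/\ size p = n.+1, size q = (n - 2).+1
        & p ^+ 2 - 'X * ('X - (a^-1)%:P) * ('X - (b^-1)%:P)
                      * ('X - (l0^-1)%:P) * q ^+ 2 = 1]).
Proof.
case: n hn => [//|[//|m]] _; rewrite !subSS subn0; split=> [per|[p [q [sp sq e]]]].
  (* One actual trajectory is required here, as the assumption quantifies over all of them. *)
  have [zs [ts [cs O]]] := orbit_exists hb hab hl0.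
  have [tr T C] := orbit_trajectory hb hab hl0 O.
  have eL := elliptic_periodic_lax hb hab hl0 O tr (per _ T C).
  exact: periodic_pell hb hab hl0 _ _ _ _ O eL.
move=> P T C; have [zs [ts [cs [O tr]]]] := trajectory_orbit hb hab hl0 T C.
apply: (lax_elliptic_periodic hb hab hl0 O tr) => k.
(* The Pell equation does not refer to the initial vertex, so it applies to the orbit started at
   [k]. *)
have := pell_periodic hb hab hl0 (orbit_shift hb hab k O) sp sq e.
by rewrite addn0.
Qed.
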